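(* Let $\mathscr{B}$ and $\mathscr{C}$ be bicategories equipped with shadow functors with target categories $\mathbf{T}$ and $\mathbf{Z}$ respectively, let $F\colon\mathscr{B}\to\mathscr{C}$ be a lax shadow functor (with constraints $\mathfrak{c},\mathfrak{i}$, functor $F_{\mathrm{tr}}\colon\mathbf{T}\to\mathbf{Z}$ and transformation $\phi$), and let $M\in\mathscr{B}(R,S)$ be a right dualizable 1-cell with right dual $M^{\bigstar}$. (i) If $\mathfrak{c}\colon F(M)\odot F(M^{\bigstar})\to F(M\odot M^{\bigstar})$ and $\mathfrak{i}\colon U_{F(S)}\to F(U_S)$ are isomorphisms, then $F(M)$ is right dualizable with right dual $F(M^{\bigstar})$. (ii) If, furthermore, $P\in\mathscr{B}(S,S)$ is such that $\mathfrak{c}_{M,P}\colon F(M)\odot F(P)\to F(M\odot P)$ is an isomorphism, then for any $Q\in\mathscr{B}(R,R)$ and any 2-cell $f\colon Q\odot M\to M\odot P$, $$\phi_P\circ \operatorname{tr}\big(\mathfrak{c}_{M,P}^{-1}\circ F(f)\circ \mathfrak{c}_{Q,M}\big)=F_{\mathrm{tr}}(\operatorname{tr}(f))\circ\phi_Q$$ as morphisms $\langle\!\langle F(Q)\rangle\!\rangle\to F_{\mathrm{tr}}\langle\!\langle P\rangle\!\rangle$ in $\mathbf{Z}$.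
   Context: Bicategories. A bicategory $\mathscr{B}$ has 0-cells $R,S,\dots$, hom-categories $\mathscr{B}(R,S)$ (objects: 1-cells; morphisms: 2-cells), units $U_R\in\mathscr{B}(R,R)$, composition functors $\odot\colon\mathscr{B}(R,S)\times\mathscr{B}(S,T)\to\mathscr{B}(R,T)$ written in diagrammatic order, and coherent natural isomorphisms $\mathfrak{a}\colon M\odot(N\odot P)\to(M\odot N)\odot P$, $\mathfrak{l}\colon U_R\odot M\to M$, $\mathfrak{r}\colon M\odot U_S\to M$. These are suppressed from composites below where no confusion results. Shadow functor. A shadow functor for $\mathscr{B}$ with target category $\mathbf{T}$ consists of functors $\langle\!\langle-\rangle\!\rangle\colon\mathscr{B}(R,R)\to\mathbf{T}$ for every 0-cell $R$ and natural isomorphisms $\theta\colon\langle\!\langle M\odot N\rangle\!\rangle\to\langle\!\langle N\odot M\rangle\!\rangle$ for $M\in\mathscr{B}(R,S)$, $N\in\mathscr{B}(S,R)$, such that, whenever it makes sense: the composite $\langle\!\langle (M\odot N)\odot P\rangle\!\rangle\xrightarrow{\theta}\langle\!\langle P\odot(M\odot N)\rangle\!\rangle\xrightarrow{\langle\!\langle\mathfrak{a}\rangle\!\rangle}\langle\!\langle(P\odot M)\odot N\rangle\!\rangle$ equals $\langle\!\langle (M\odot N)\odot P\rangle\!\rangle\xrightarrow{\langle\!\langle\mathfrak{a}^{-1}\rangle\!\rangle}\langle\!\langle M\odot (N\odot P)\rangle\!\rangle\xrightarrow{\theta}\langle\!\langle (N\odot P)\odot M\rangle\!\rangle\xrightarrow{\langle\!\langle\mathfrak{a}^{-1}\rangle\!\rangle}\langle\!\langle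 N\odot(P\odot M)\rangle\!\rangle\xrightarrow{\theta}\langle\!\langle(P\odot M)\odot N\rangle\!\rangle$; and $\langle\!\langle\mathfrak{l}\rangle\!\rangle\circ\theta=\langle\!\langle\mathfrak{r}\rangle\!\rangle$ on $\langle\!\langle M\odot U_R\rangle\!\rangle$ and $\langle\!\langle\mathfrak{r}\rangle\!\rangle\circ\theta=\langle\!\langle\mathfrak{l}\rangle\!\rangle$ on $\langle\!\langle U_R\odot M\rangle\!\rangle$. Duality. $M\in\mathscr{B}(R,S)$ is right dualizable with right dual $M^{\bigstar}\in\mathscr{B}(S,R)$ if there are 2-cells $\eta\colon U_R\to M\odot M^{\bigstar}$ and $\varepsilon\colon M^{\bigstar}\odot M\to U_S$ satisfying the triangle identities $(\mathrm{id}_M\odot\varepsilon)(\eta\odot\mathrm{id}_M)=\mathrm{id}_M$ and $(\varepsilon\odot\mathrm{id}_{M^{\bigstar}})(\mathrm{id}_{M^{\bigstar}}\odot\eta)=\mathrm{id}_{M^{\bigstar}}$. Trace. For $M\in\mathscr{B}(R,S)$ right dualizable, $Q\in\mathscr{B}(R,R)$, $P\in\mathscr{B}(S,S)$ and a 2-cell $f\colon Q\odot M\to M\odot P$, the trace $\operatorname{tr}(f)$ is the composite $$\langle\!\langle Q\rangle\!\rangle\xrightarrow{\langle\!\langle\mathrm{id}\odot\eta\rangle\!\rangle}\langle\!\langle Q\odot M\odot M^{\bigstar}\rangle\!\rangle\xrightarrow{\langle\!\langle f\odot\mathrm{id}\rangle\!\rangle}\langle\!\langle M\odot P\odot M^{\bigstar}\rangle\!\rangle\xrightarrow{\theta}\langle\!\langle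 M^{\bigstar}\odot M\odot P\rangle\!\rangle\xrightarrow{\langle\!\langle\varepsilon\odot\mathrm{id}\rangle\!\rangle}\langle\!\langle P\rangle\!\rangle,$$ which does not depend on the choice of $M^{\bigstar},\eta,\varepsilon$. In (ii), the left-hand trace is taken in $\mathscr{C}$ with respect to $F(M)$. Lax functor. A lax functor $F\colon\mathscr{B}\to\mathscr{C}$ consists of a function on 0-cells, functors $F\colon\mathscr{B}(R,S)\to\mathscr{C}(F(R),F(S))$, and natural transformations $\mathfrak{c}_{M,N}\colon F(M)\odot F(N)\to F(M\odot N)$ and $\mathfrak{i}\colon U_{F(R)}\to F(U_R)$ such that $\mathfrak{c}\circ(\mathfrak{c}\odot\mathrm{id})\circ\mathfrak{a}=F(\mathfrak{a})\circ\mathfrak{c}\circ(\mathrm{id}\odot\mathfrak{c})$, $F(\mathfrak{l})\circ\mathfrak{c}\circ(\mathfrak{i}\odot\mathrm{id})=\mathfrak{l}$ and $F(\mathfrak{r})\circ\mathfrak{c}\circ(\mathrm{id}\odot\mathfrak{i})=\mathfrak{r}$. Lax shadow functor. If $\mathscr{B},\mathscr{C}$ have shadow functors with targets $\mathbf{T},\mathbf{Z}$, a lax shadow functor is a lax functor $F\colon\mathscr{B}\to\mathscr{C}$ together with a functor $F_{\mathrm{tr}}\colon\mathbf{T}\to\mathbf{Z}$ and a natural transformation $\phi_M\colon\langle\!\langle F(M)\rangle\!\rangle\to F_{\mathrm{tr}}\langle\!\langle M\rangle\!\rangle$ (for endo-1-cells $M$) such that, for all $M\in\mathscr{B}(R,S)$,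 $N\in\mathscr{B}(S,R)$, $F_{\mathrm{tr}}(\theta)\circ\phi_{M\odot N}\circ\langle\!\langle\mathfrak{c}_{M,N}\rangle\!\rangle=\phi_{N\odot M}\circ\langle\!\langle\mathfrak{c}_{N,M}\rangle\!\rangle\circ\theta$ as maps $\langle\!\langle F(M)\odot F(N)\rangle\!\rangle\to F_{\mathrm{tr}}\langle\!\langle N\odot M\rangle\!\rangle$. *)

(* Defs.v *)
From mathcomp Require Import ssreflect.

Set Implicit Arguments.
Unset Strict Implicit.
Unset Printing Implicit Defensive.

Declare Scope bicat_scope.
Delimit Scope bicat_scope with bicat.
Open Scope bicat_scope.

Reserved Notation "X ~> Y" (at level 70, no associativity).
Reserved Notation "g ∘ f" (at level 40, left associativity).
Reserved Notation "M ⊙ N" (at level 35, no associativity).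
Reserved Notation "α ⊗ β" (at level 35, no associativity).

Record category : Type := Category {
  ob :> Type;
  hom : ob -> ob -> Type;
  idm : forall X, hom X X;
  comp : forall {X Y Z}, hom Y Z -> hom X Y -> hom X Z;
  comp_idl : forall X Y (f : hom X Y), comp (idm Y) f = f;
  comp_idr : forall X Y (f : hom X Y), comp f (idm X) = f;
  comp_assoc : forall W X Y Z (h : hom Y Z) (g : hom X Y) (f : hom W X),
    comp h (comp g f) = comp (comp h g) f
}.

Arguments hom {c} X Y.
Arguments idm {c} X.
Arguments comp {c X Y Z} g f.

Notation "X ~> Y" := (hom X Y) : bicat_scope.
Notation "g ∘ f" := (comp g f) : bicat_scope.

Definition is_inverse (C : category) (X Y : C) (f : X ~> Y) (g : Y ~> X) : Prop :=
  g ∘ f = idm X /\ f ∘ g = idm Y.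

Definition is_iso (C : category) (X Y : C) (f : X ~> Y) : Prop :=
  exists g : Y ~> X, is_inverse f g.

Record functor (C D : category) : Type := Functor {
  fob :> C -> D;
  fmap : forall {X Y : C}, X ~> Y -> fob X ~> fob Y;
  fmap_id : forall X : C, fmap (idm X) = idm (fob X);
  fmap_comp : forall (X Y Z : C) (g : Y ~> Z) (f : X ~> Y),
    fmap (g ∘ f) = fmap g ∘ fmap f
}.

Arguments fmap {C D} F {X Y} f : rename.

(* Composition of 1-cells is diagrammatic: M : B R S and N : B S T give
   M ⊙ N : B R T.  Vertical composition α ∘ β of 2-cells is in the usual order
   (β first).  The paper's symbol ⊙ on 2-cells is written ⊗ here. *)
Record bicategory : Type := Bicategory {
  cell0 :> Type;
  hcat :> cell0 -> cell0 -> category;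
  unit1 : forall R, hcat R R;
  hcomp1 : forall {R S T}, hcat R S -> hcat S T -> hcat R T
    where "M ⊙ N" := (hcomp1 M N);
  hcomp2 : forall {R S T} {M M' : hcat R S} {N N' : hcat S T},
    M ~> M' -> N ~> N' -> M ⊙ N ~> M' ⊙ N'
    where "α ⊗ β" := (hcomp2 α β);
  hcomp2_id : forall R S T (M : hcat R S) (N : hcat S T),
    idm M ⊗ idm N = idm (M ⊙ N);
  hcomp2_comp : forall R S T (M M' M'' : hcat R S) (N N' N'' : hcat S T)
    (α' : M' ~> M'') (α : M ~> M') (β' : N' ~> N'') (β : N ~> N'),
    (α' ∘ α) ⊗ (β' ∘ β) = (α' ⊗ β') ∘ (α ⊗ β);

  assoc : forall {R S T V} (M : hcat R S) (N : hcat S T) (P : hcat T V),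
    M ⊙ (N ⊙ P) ~> (M ⊙ N) ⊙ P;
  associ : forall {R S T V} (M : hcat R S) (N : hcat S T) (P : hcat T V),
    (M ⊙ N) ⊙ P ~> M ⊙ (N ⊙ P);
  assoc_iso : forall R S T V (M : hcat R S) (N : hcat S T) (P : hcat T V),
    is_inverse (assoc M N P) (associ M N P);
  assoc_nat : forall R S T V (M M' : hcat R S) (N N' : hcat S T) (P P' : hcat T V)
    (α : M ~> M') (β : N ~> N') (γ : P ~> P'),
    assoc M' N' P' ∘ (α ⊗ (β ⊗ γ)) = ((α ⊗ β) ⊗ γ) ∘ assoc M N P;

  lunit : forall {R S} (M : hcat R S), unit1 R ⊙ M ~> M;
  luniti : forall {R S} (M : hcat R S), M ~> unit1 R ⊙ M;
  lunit_iso : forall R S (M : hcat R S), is_inverse (lunit M) (luniti M);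
  lunit_nat : forall R S (M M' : hcat R S) (α : M ~> M'),
    lunit M' ∘ (idm (unit1 R) ⊗ α) = α ∘ lunit M;

  runit : forall {R S} (M : hcat R S), M ⊙ unit1 S ~> M;
  runiti : forall {R S} (M : hcat R S), M ~> M ⊙ unit1 S;
  runit_iso : forall R S (M : hcat R S), is_inverse (runit M) (runiti M);
  runit_nat : forall R S (M M' : hcat R S) (α : M ~> M'),
    runit M' ∘ (α ⊗ idm (unit1 S)) = α ∘ runit M;

  pentagon : forall R S T V W
    (M : hcat R S) (N : hcat S T) (P : hcat T V) (Q : hcat V W),
    assoc (M ⊙ N) P Q ∘ assoc M N (P ⊙ Q)
    = (assoc M N P ⊗ idm Q) ∘ assoc M (N ⊙ P) Q ∘ (idm M ⊗ assoc N P Q);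
  triangle : forall R S T (M : hcat R S) (N : hcat S T),
    (runit M ⊗ idm N) ∘ assoc M (unit1 S) N = idm M ⊗ lunit N
}.

Arguments unit1 {b} R.
Arguments hcomp1 {b R S T} M N.
Arguments hcomp2 {b R S T M M' N N'} α β.
Arguments assoc {b R S T V} M N P.
Arguments associ {b R S T V} M N P.
Arguments lunit {b R S} M.
Arguments luniti {b R S} M.
Arguments runit {b R S} M.
Arguments runiti {b R S} M.

Notation "M ⊙ N" := (hcomp1 M N) : bicat_scope.
Notation "α ⊗ β" := (hcomp2 α β) : bicat_scope.

Record shadow_functor (B : bicategory) (T : category) : Type := ShadowFunctor {
  shadow : forall {R : B}, functor (B R R) T;
  theta : forall {R S : B} (M : B R S) (N : B S R), shadow (M ⊙ N) ~> shadow (N ⊙ M);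
  theta_iso : forall (R S : B) (M : B R S) (N : B S R), is_iso (theta M N);
  theta_nat : forall (R S : B) (M M' : B R S) (N N' : B S R)
    (α : M ~> M') (β : N ~> N'),
    theta M' N' ∘ fmap shadow (α ⊗ β) = fmap shadow (β ⊗ α) ∘ theta M N;
  theta_assoc : forall (R S V : B) (M : B R S) (N : B S V) (P : B V R),
    fmap shadow (assoc P M N) ∘ theta (M ⊙ N) P
    = theta N (P ⊙ M) ∘ fmap shadow (associ N P M) ∘ theta M (N ⊙ P)
      ∘ fmap shadow (associ M N P);
  theta_lunit : forall (R : B) (M : B R R),
    fmap shadow (lunit M) ∘ theta M (unit1 R) = fmap shadow (runit M);
  theta_runit : forall (R : B) (M : B R R),
    fmap shadow (runit M) ∘ theta (unit1 R) M = fmap shadow (lunit M)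
}.

Arguments shadow {B T} s {R}.
Arguments theta {B T} s {R S} M N.

(* The data exhibiting N as a right dual of M. *)
Record duality (B : bicategory) (R S : B) (M : B R S) (N : B S R) : Type := Duality {
  coev : unit1 R ~> M ⊙ N;
  ev : N ⊙ M ~> unit1 S;
  triangle_left :
    runit M ∘ (idm M ⊗ ev) ∘ associ M N M ∘ (coev ⊗ idm M) ∘ luniti M = idm M;
  triangle_right :
    lunit N ∘ (ev ⊗ idm N) ∘ assoc N M N ∘ (idm N ⊗ coev) ∘ runiti N = idm N
}.

Definition is_right_dual (B : bicategory) (R S : B) (M : B R S) (N : B S R) : Prop :=
  inhabited (duality M N).

Definition trace (B : bicategory) (T : category) (sh : shadow_functor B T)
    (R S : B) (M : B R S) (N : B S R) (D : duality M N) (Q : B R R) (P : B S S)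
    (f : Q ⊙ M ~> M ⊙ P) : shadow sh Q ~> shadow sh P :=
  fmap (shadow sh) (lunit P)
  ∘ fmap (shadow sh) (ev D ⊗ idm P)
  ∘ fmap (shadow sh) (assoc N M P)
  ∘ theta sh (M ⊙ P) N
  ∘ fmap (shadow sh) (f ⊗ idm N)
  ∘ fmap (shadow sh) (assoc Q M N)
  ∘ fmap (shadow sh) (idm Q ⊗ coev D)
  ∘ fmap (shadow sh) (runiti Q).

Record lax_functor (B C : bicategory) : Type := LaxFunctor {
  lax0 : B -> C;
  lax : forall {R S : B}, functor (B R S) (C (lax0 R) (lax0 S));
  lax_comp : forall {R S T : B} (M : B R S) (N : B S T),
    lax M ⊙ lax N ~> lax (M ⊙ N);
  lax_comp_nat : forall (R S T : B) (M M' : B R S) (N N' : B S T)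
    (α : M ~> M') (β : N ~> N'),
    lax_comp M' N' ∘ (fmap lax α ⊗ fmap lax β) = fmap lax (α ⊗ β) ∘ lax_comp M N;
  lax_unit : forall R : B, unit1 (lax0 R) ~> lax (unit1 R);
  lax_assoc : forall (R S T V : B) (M : B R S) (N : B S T) (P : B T V),
    lax_comp (M ⊙ N) P ∘ (lax_comp M N ⊗ idm (lax P)) ∘ assoc (lax M) (lax N) (lax P)
    = fmap lax (assoc M N P) ∘ lax_comp M (N ⊙ P) ∘ (idm (lax M) ⊗ lax_comp N P);
  lax_lunit : forall (R S : B) (M : B R S),
    fmap lax (lunit M) ∘ lax_comp (unit1 R) M ∘ (lax_unit R ⊗ idm (lax M))
    = lunit (lax M);
  lax_runit : forall (R S : B) (M : B R S),
    fmap lax (runit M) ∘ lax_comp M (unit1 S) ∘ (idm (lax M) ⊗ lax_unit S)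
    = runit (lax M)
}.

Arguments lax0 {B C} F R : rename.
Arguments lax {B C} F {R S} : rename.
Arguments lax_comp {B C} F {R S T} M N : rename.
Arguments lax_unit {B C} F R : rename.

Record lax_shadow_functor (B C : bicategory) (T Z : category)
    (shB : shadow_functor B T) (shC : shadow_functor C Z) : Type := LaxShadowFunctor {
  lsf_lax :> lax_functor B C;
  lsf_tr : functor T Z;
  lsf_phi : forall {R : B} (M : B R R),
    shadow shC (lax lsf_lax M) ~> lsf_tr (shadow shB M);
  lsf_phi_nat : forall (R : B) (M M' : B R R) (α : M ~> M'),
    lsf_phi M' ∘ fmap (shadow shC) (fmap (lax lsf_lax) α)
    = fmap lsf_tr (fmap (shadow shB) α) ∘ lsf_phi M;
  lsf_phi_theta : forall (R S : B) (M : B R S) (N : B S R),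
    fmap lsf_tr (theta shB M N) ∘ lsf_phi (M ⊙ N)
      ∘ fmap (shadow shC) (lax_comp lsf_lax M N)
    = lsf_phi (N ⊙ M) ∘ fmap (shadow shC) (lax_comp lsf_lax N M)
      ∘ theta shC (lax lsf_lax M) (lax lsf_lax N)
}.

Arguments lsf_tr {B C T Z shB shC} F : rename.
Arguments lsf_phi {B C T Z shB shC} F {R} M : rename.

(* Main.v *)
Require Import Defs.
From mathcomp Require Import ssreflect ssrfun.

Set Implicit Arguments.
Unset Strict Implicit.
Unset Printing Implicit Defensive.

(** The functor F carries every formal consequence of the duality (M, M⋆) to
    its image, so only the constraints c and i can get in the way of F M being
    dualizable.  When c_{M,M⋆} and i_S are invertible, put
      eta' = c^-1 ∘ F eta ∘ i    and    eps' = i^-1 ∘ F eps ∘ c.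
    The lax unit law rewrites the unit isomorphisms of C as images of those of
    B, after which c is moved past each factor by naturality and by the lax
    associativity law; either triangle composite for (eta', eps') becomes the
    image under F of the one for (eta, eps) ([lax_duality]).

    The trace splits at θ into a part before it, in which f and eta occur, and
    a part after it, in which eps occurs.  The same computation identifies each
    part for F M with the F-image of the part for M, up to c
    ([lax_trace_source] and [lax_trace_target]).  Between the two stand θ, φ
    and constraints c; exchanging them is the axiom relating φ and θ.  This
    proves the formula for the trace formed with (eta', eps').

    An arbitrary right dual of F M is reached by independence of the trace from
    the dual ([trace_dual_irrelevant]): two right duals N, N' of the same 1-cell
    are compared by a 2-cell u : N ~> N' carrying one unit and counit to the
    other, and u slides through θ by naturality.  The comparison of the units
    and counits needs the coherence laws for the unit isomorphisms at a
    composite 1-cell, which are consequences of the pentagon and triangle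
    (Kelly). *)

(** * Cancellation and whiskering *)

Section Category.
Variable A : category.

(** Rewriting with [precomp e] applies the equation e at the head of a
    right-nested composite. *)
Lemma precomp (W X Y Y' V : A) (g : Y ~> V) (f : X ~> Y) (g' : Y' ~> V) (f' : X ~> Y')
  (e : g ∘ f = g' ∘ f') (h : W ~> X) : g ∘ (f ∘ h) = g' ∘ (f' ∘ h).
Proof. by rewrite !comp_assoc e. Qed.

Lemma precomp1 (W X Y V : A) (g : Y ~> V) (f : X ~> Y) (k : X ~> V)
  (e : g ∘ f = k) (h : W ~> X) : g ∘ (f ∘ h) = k ∘ h.
Proof. by rewrite comp_assoc e. Qed.

Lemma inverse_cancel (W X Y : A) (f : X ~> Y) (g : Y ~> X) (h : W ~> X) :
  is_inverse f g -> g ∘ (f ∘ h) = h.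
Proof. by case=> gf _; rewrite comp_assoc gf comp_idl. Qed.

Lemma inverse_sym (X Y : A) (f : X ~> Y) (g : Y ~> X) :
  is_inverse f g -> is_inverse g f.
Proof. by case. Qed.

Lemma inverse_epi (X Y V : A) (f : X ~> Y) (g : Y ~> X) (h k : Y ~> V) :
  is_inverse f g -> h ∘ f = k ∘ f -> h = k.
Proof.
case=> _ fg e; rewrite -(comp_idr h) -(comp_idr k) -fg.
by rewrite !comp_assoc e.
Qed.

Lemma inverse_mono (W X Y : A) (f : X ~> Y) (g : Y ~> X) (h k : W ~> X) :
  is_inverse f g -> f ∘ h = f ∘ k -> h = k.
Proof.
by move=> fg e; rewrite -(inverse_cancel h fg) e (inverse_cancel k fg).
Qed.

End Category.

Lemma fmap_inverse (A A' : category) (G : functor A A') (X Y : A)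
  (f : X ~> Y) (g : Y ~> X) :
  is_inverse f g -> is_inverse (fmap G f) (fmap G g).
Proof. by case=> gf fg; split; rewrite -fmap_comp ?gf ?fg fmap_id. Qed.

Section Bicategory.
Variable B : bicategory.

Lemma whiskerR_comp (R S T : B) (M M' M'' : B R S) (N : B S T)
  (α' : M' ~> M'') (α : M ~> M') :
  (α' ∘ α) ⊗ idm N = (α' ⊗ idm N) ∘ (α ⊗ idm N).
Proof. by rewrite -hcomp2_comp comp_idl. Qed.

Lemma whiskerL_comp (R S T : B) (M : B R S) (N N' N'' : B S T)
  (β' : N' ~> N'') (β : N ~> N') :
  idm M ⊗ (β' ∘ β) = (idm M ⊗ β') ∘ (idm M ⊗ β).
Proof. by rewrite -hcomp2_comp comp_idl. Qed.

Lemma whisker_exchange (R S T : B) (M M' : B R S) (N N' : B S T)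
  (α : M ~> M') (β : N ~> N') :
  (idm M' ⊗ β) ∘ (α ⊗ idm N) = (α ⊗ idm N') ∘ (idm M ⊗ β).
Proof. by rewrite -!hcomp2_comp !comp_idl !comp_idr. Qed.

Lemma whiskerR_inverse (R S T : B) (M M' : B R S) (N : B S T)
  (α : M ~> M') (α' : M' ~> M) :
  is_inverse α α' -> is_inverse (α ⊗ idm N) (α' ⊗ idm N).
Proof. by case=> e e'; split; rewrite -whiskerR_comp ?e ?e' hcomp2_id. Qed.

Lemma whiskerL_inverse (R S T : B) (M : B R S) (N N' : B S T)
  (β : N ~> N') (β' : N' ~> N) :
  is_inverse β β' -> is_inverse (idm M ⊗ β) (idm M ⊗ β').
Proof. by case=> e e'; split; rewrite -whiskerL_comp ?e ?e' hcomp2_id. Qed.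

(** The unit isomorphisms make whiskering by a unit 1-cell isomorphic to the
    identity functor. *)
Lemma whiskerL_unit_inj (R S : B) (M M' : B R S) (α β : M ~> M') :
  idm (unit1 R) ⊗ α = idm (unit1 R) ⊗ β -> α = β.
Proof.
by move=> e; apply: (inverse_epi (lunit_iso M)); rewrite -!lunit_nat e.
Qed.

Lemma whiskerR_unit_inj (R S : B) (M M' : B R S) (α β : M ~> M') :
  α ⊗ idm (unit1 S) = β ⊗ idm (unit1 S) -> α = β.
Proof.
by move=> e; apply: (inverse_epi (runit_iso M)); rewrite -!runit_nat e.
Qed.

(** Plain naturality splits id_{N ⊙ P} into id_N ⊗ id_P; these forms keep it
    whole, as whiskering by a composite 1-cell requires. *)
Lemma assoc_natl (R S T V : B) (M M' : B R S) (N : B S T) (P : B T V)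
  (α : M ~> M') :
  assoc M' N P ∘ (α ⊗ idm (N ⊙ P)) = ((α ⊗ idm N) ⊗ idm P) ∘ assoc M N P.
Proof. by rewrite -assoc_nat hcomp2_id. Qed.

Lemma assoc_natr (R S T V : B) (M : B R S) (N : B S T) (P P' : B T V)
  (γ : P ~> P') :
  assoc M N P' ∘ (idm M ⊗ (idm N ⊗ γ)) = (idm (M ⊙ N) ⊗ γ) ∘ assoc M N P.
Proof. by rewrite assoc_nat hcomp2_id. Qed.

(** * Coherence of the unit isomorphisms *)

(** Kelly's argument: contract the second unit in the pentagon at (U, U, M, N).
    By the triangle axiom and naturality its two sides become the two sides of
    the claim, whiskered by U and followed by an associator. *)
Lemma lunit_hcomp1 (R S T : B) (M : B R S) (N : B S T) :
  (lunit M ⊗ idm N) ∘ assoc (unit1 R) M N = lunit (M ⊙ N).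
Proof.
apply: whiskerL_unit_inj; rewrite whiskerL_comp.
apply: (inverse_mono (assoc_iso (unit1 R) M N)).
rewrite (precomp (assoc_nat _ _ _)) -!triangle whiskerR_comp.
rewrite (precomp (assoc_natl _ _ _)) pentagon.
by rewrite !comp_assoc.
Qed.

(** The mirror image, contracting the first unit in the pentagon at
    (M, N, U, U). *)
Lemma runit_hcomp1 (R S T : B) (M : B R S) (N : B S T) :
  runit (M ⊙ N) ∘ assoc M N (unit1 T) = idm M ⊗ runit N.
Proof.
apply: whiskerR_unit_inj; rewrite whiskerR_comp.
apply: (inverse_epi (assoc_iso M (N ⊙ unit1 T) (unit1 T))).
apply: (inverse_epi (whiskerL_inverse M (assoc_iso N (unit1 T) (unit1 T)))).
rewrite -!comp_assoc [in LHS](comp_assoc (assoc M N _ ⊗ _)) -pentagon.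
rewrite comp_assoc triangle -assoc_natr -triangle whiskerL_comp.
by rewrite (precomp (assoc_nat _ _ _)).
Qed.

(** Naturality of the left unit at its own component gives
    lunit (U ⊙ U) = id ⊗ lunit U; the two sides are lunit U ⊗ id and runit U ⊗ id
    up to the associator. *)
Lemma lunit_unit1 (R : B) : lunit (unit1 R) = runit (unit1 R).
Proof.
apply: whiskerR_unit_inj.
apply: (inverse_epi (assoc_iso (unit1 R) (unit1 R) (unit1 R))).
rewrite triangle lunit_hcomp1.
by apply: (inverse_mono (lunit_iso (unit1 R))); rewrite lunit_nat.
Qed.

(** * Uniqueness of duals and independence of the trace *)

(** With the inverse unit isomorphism moved across, a triangle identity can be
    used inside a longer composite, where nothing cancels that inverse. *)
Lemma duality_lunit (R S : B) (M : B R S) (N : B S R) (D : duality M N) :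
  runit M ∘ ((idm M ⊗ ev D) ∘ (associ M N M ∘ (coev D ⊗ idm M))) = lunit M.
Proof.
apply: (inverse_epi (inverse_sym (lunit_iso M))).
by rewrite (proj2 (lunit_iso M)) !comp_assoc triangle_left.
Qed.

Lemma duality_runit (R S : B) (M : B R S) (N : B S R) (D : duality M N) :
  lunit N ∘ ((ev D ⊗ idm N) ∘ (assoc N M N ∘ (idm N ⊗ coev D))) = runit N.
Proof.
apply: (inverse_epi (inverse_sym (runit_iso N))).
by rewrite (proj2 (runit_iso N)) !comp_assoc triangle_right.
Qed.

Lemma runit_associ (R S T : B) (M : B R S) (N : B S T) :
  (idm M ⊗ runit N) ∘ associ M N (unit1 T) = runit (M ⊙ N).
Proof.
by rewrite -runit_hcomp1 -comp_assoc (proj2 (assoc_iso _ _ _)) comp_idr.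
Qed.

Lemma lunit_associ (R S T : B) (M : B R S) (N : B S T) :
  lunit (M ⊙ N) ∘ associ (unit1 R) M N = lunit M ⊗ idm N.
Proof.
by rewrite -lunit_hcomp1 -comp_assoc (proj2 (assoc_iso _ _ _)) comp_idr.
Qed.

Lemma associ_nat (R S T V : B) (M M' : B R S) (N N' : B S T) (P P' : B T V)
  (α : M ~> M') (β : N ~> N') (γ : P ~> P') :
  associ M' N' P' ∘ ((α ⊗ β) ⊗ γ) = (α ⊗ (β ⊗ γ)) ∘ associ M N P.
Proof.
apply: (inverse_epi (assoc_iso M N P)).
rewrite -!comp_assoc (proj1 (assoc_iso M N P)) comp_idr -assoc_nat.
by rewrite (inverse_cancel _ (assoc_iso _ _ _)).
Qed.

(** The next two rotations of the pentagon bring together the coev and ev of a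
    single duality inside a composite of two. *)
Lemma pentagon_left (R S T V W : B)
  (M : B R S) (N : B S T) (P : B T V) (Q : B V W) :
  assoc M (N ⊙ P) Q ∘ ((idm M ⊗ assoc N P Q) ∘ associ M N (P ⊙ Q))
  = (associ M N P ⊗ idm Q) ∘ assoc (M ⊙ N) P Q.
Proof.
apply: (inverse_mono (whiskerR_inverse Q (assoc_iso M N P))).
rewrite (inverse_cancel _ (inverse_sym (whiskerR_inverse _ (assoc_iso _ _ _)))).
rewrite !comp_assoc -pentagon -comp_assoc.
by rewrite (proj2 (assoc_iso M N (P ⊙ Q))) comp_idr.
Qed.

Lemma pentagon_right (R S T V W : B)
  (M : B R S) (N : B S T) (P : B T V) (Q : B V W) :
  associ (M ⊙ N) P Q ∘ ((assoc M N P ⊗ idm Q) ∘ assoc M (N ⊙ P) Q)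
  = assoc M N (P ⊙ Q) ∘ (idm M ⊗ associ N P Q).
Proof.
apply: (inverse_epi (whiskerL_inverse M (assoc_iso N P Q))).
rewrite -!comp_assoc (comp_assoc (_ ⊗ _)) -pentagon.
rewrite (inverse_cancel _ (assoc_iso _ _ _)).
by rewrite (proj1 (whiskerL_inverse _ (assoc_iso N P Q))) comp_idr.
Qed.

(** The mate of id_M under the two dualities. *)
Definition dual_comparison (R S : B) (M : B R S) (N N' : B S R)
    (D : duality M N) (D' : duality M N') : N ~> N' :=
  lunit N' ∘ (ev D ⊗ idm N') ∘ assoc N M N' ∘ (idm N ⊗ coev D') ∘ runiti N.

Lemma dual_comparison_runit (R S : B) (M : B R S) (N N' : B S R)
  (D : duality M N) (D' : duality M N') :
  dual_comparison D D' ∘ runit N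
  = lunit N' ∘ ((ev D ⊗ idm N') ∘ (assoc N M N' ∘ (idm N ⊗ coev D'))).
Proof.
by rewrite /dual_comparison -!comp_assoc (proj1 (runit_iso N)) comp_idr.
Qed.

(** In the composite, coev D and ev D meet in a triangle identity for D once
    coev D' has been moved to the right of them by exchange. *)
Lemma dual_comparison_coev (R S : B) (M : B R S) (N N' : B S R)
  (D : duality M N) (D' : duality M N') :
  (idm M ⊗ dual_comparison D D') ∘ coev D = coev D'.
Proof.
apply: (inverse_epi (runit_iso (unit1 R))).
rewrite -comp_assoc -runit_nat -runit_associ -!comp_assoc.
rewrite (precomp1 (esym (whiskerL_comp _ _ _))) dual_comparison_runit.
rewrite !whiskerL_comp -triangle -!comp_assoc.
rewrite (precomp (assoc_nat _ _ _)).
have -> : (idm M ⊗ (idm N ⊗ coev D')) ∘ (associ M N (unit1 R) ∘ (coev D ⊗ idm (unit1 R)))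
  = associ M N (M ⊙ N') ∘ ((coev D ⊗ idm (M ⊙ N')) ∘ (idm (unit1 R) ⊗ coev D')).
  by rewrite -whisker_exchange -hcomp2_id (precomp (associ_nat _ _ _)).
rewrite (comp_assoc (idm M ⊗ assoc _ _ _)) (precomp (pentagon_left _ _ _ _)).
rewrite (precomp (assoc_natl _ _ _)).
do 3!rewrite (precomp1 (esym (whiskerR_comp _ _ _))).
rewrite -!comp_assoc duality_lunit (precomp1 (lunit_hcomp1 _ _)).
by rewrite lunit_nat lunit_unit1.
Qed.

(** Here the triangle identity used is the one for D', and it is ev D that
    exchanges with ev D'. *)
Lemma dual_comparison_ev (R S : B) (M : B R S) (N N' : B S R)
  (D : duality M N) (D' : duality M N') :
  ev D' ∘ (dual_comparison D D' ⊗ idm M) = ev D.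
Proof.
apply: (inverse_epi (whiskerR_inverse M (runit_iso N))).
apply: (inverse_epi (assoc_iso N (unit1 R) M)).
rewrite -!comp_assoc (precomp1 (esym (whiskerR_comp _ _ _))) triangle.
rewrite dual_comparison_runit !whiskerR_comp -!comp_assoc.
rewrite -lunit_associ -assoc_nat -!comp_assoc.
rewrite (precomp (associ_nat _ _ _)) hcomp2_id.
rewrite (comp_assoc (assoc _ _ _ ⊗ _)) (precomp1 (pentagon_right _ _ _ _)).
rewrite -!comp_assoc (precomp (esym (lunit_nat _))).
rewrite (precomp (whisker_exchange _ _)) (precomp (esym (assoc_natr _ _ _))).
rewrite -!whiskerL_comp lunit_unit1.
rewrite (precomp (runit_nat _)) (precomp1 (runit_hcomp1 _ _)).
by rewrite -whiskerL_comp duality_lunit.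
Qed.

Section Trace.
Variables (T : category) (sh : shadow_functor B T).

Lemma trace_split (R S : B) (M : B R S) (N : B S R) (D : duality M N)
  (Q : B R R) (P : B S S) (f : Q ⊙ M ~> M ⊙ P) :
  trace sh D f
  = fmap (shadow sh) (lunit P ∘ ((ev D ⊗ idm P) ∘ assoc N M P))
    ∘ (theta sh (M ⊙ P) N
       ∘ fmap (shadow sh)
           ((f ⊗ idm N) ∘ (assoc Q M N ∘ ((idm Q ⊗ coev D) ∘ runiti Q)))).
Proof. by rewrite /trace !fmap_comp -!comp_assoc. Qed.

(** Writing coev D' as coev D followed by the comparison 2-cell, that 2-cell
    commutes with f and passes through θ to be absorbed by ev D'. *)
Lemma trace_dual_irrelevant (R S : B) (M : B R S) (N N' : B S R)
  (D : duality M N) (D' : duality M N') (Q : B R R) (P : B S S)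
  (f : Q ⊙ M ~> M ⊙ P) :
  trace sh D f = trace sh D' f.
Proof.
set u := dual_comparison D D'.
have before : (f ⊗ idm N') ∘ (assoc Q M N' ∘ ((idm Q ⊗ coev D') ∘ runiti Q))
    = (idm (M ⊙ P) ⊗ u)
      ∘ ((f ⊗ idm N) ∘ (assoc Q M N ∘ ((idm Q ⊗ coev D) ∘ runiti Q))).
  rewrite (precomp (whisker_exchange f u)).
  rewrite -(dual_comparison_coev D D') whiskerL_comp -!comp_assoc.
  by rewrite (precomp (assoc_natr _ _ _)).
have after : lunit P ∘ ((ev D' ⊗ idm P) ∘ assoc N' M P) ∘ (u ⊗ idm (M ⊙ P))
    = lunit P ∘ ((ev D ⊗ idm P) ∘ assoc N M P).
  rewrite -!comp_assoc assoc_natl (precomp1 (esym (whiskerR_comp _ _ _))).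
  by rewrite dual_comparison_ev.
rewrite !trace_split before -after !fmap_comp -!comp_assoc.
by rewrite [X in _ = _ ∘ (_ ∘ (_ ∘ X))](precomp (theta_nat _ _ _)).
Qed.

End Trace.
End Bicategory.

(** * Lax functors and duals *)

Section LaxFunctor.
Variables (B C : bicategory) (F : lax_functor B C).

Lemma lax_comp_natl (R S T : B) (M M' : B R S) (N : B S T) (α : M ~> M') :
  lax_comp F M' N ∘ (fmap (lax F) α ⊗ idm (lax F N))
  = fmap (lax F) (α ⊗ idm N) ∘ lax_comp F M N.
Proof. by rewrite -lax_comp_nat fmap_id. Qed.

Lemma lax_comp_natr (R S T : B) (M : B R S) (N N' : B S T) (β : N ~> N') :
  lax_comp F M N' ∘ (idm (lax F M) ⊗ fmap (lax F) β)
  = fmap (lax F) (idm M ⊗ β) ∘ lax_comp F M N.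
Proof. by rewrite -lax_comp_nat fmap_id. Qed.

Lemma lax_associ (R S T V : B) (M : B R S) (N : B S T) (P : B T V) :
  lax_comp F M (N ⊙ P) ∘ ((idm (lax F M) ⊗ lax_comp F N P)
    ∘ associ (lax F M) (lax F N) (lax F P))
  = fmap (lax F) (associ M N P)
    ∘ (lax_comp F (M ⊙ N) P ∘ (lax_comp F M N ⊗ idm (lax F P))).
Proof.
apply: (inverse_epi (assoc_iso (lax F M) (lax F N) (lax F P))).
rewrite -!comp_assoc (proj1 (assoc_iso _ _ _)) comp_idr (comp_assoc (lax_comp F (M ⊙ N) P)).
rewrite lax_assoc -!comp_assoc.
by rewrite (inverse_cancel _ (fmap_inverse _ (assoc_iso _ _ _))).
Qed.

Section Duality.
Variables (R S : B) (M : B R S) (N : B S R) (D : duality M N).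
Variables (ci : lax F (M ⊙ N) ~> lax F M ⊙ lax F N)
          (ii : lax F (unit1 S) ~> unit1 (lax0 F S)).
Hypotheses (ciP : is_inverse (lax_comp F M N) ci)
           (iiP : is_inverse (lax_unit F S) ii).

Definition lax_coev : unit1 (lax0 F R) ~> lax F M ⊙ lax F N :=
  ci ∘ (fmap (lax F) (coev D) ∘ lax_unit F R).

Definition lax_ev : lax F N ⊙ lax F M ~> unit1 (lax0 F S) :=
  ii ∘ (fmap (lax F) (ev D) ∘ lax_comp F N M).

Lemma lax_comp_coev :
  lax_comp F M N ∘ lax_coev = fmap (lax F) (coev D) ∘ lax_unit F R.
Proof. by rewrite (inverse_cancel _ (inverse_sym ciP)). Qed.

Lemma lax_unit_ev :
  lax_unit F S ∘ lax_ev = fmap (lax F) (ev D) ∘ lax_comp F N M.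
Proof. by rewrite (inverse_cancel _ (inverse_sym iiP)). Qed.

(** The part of the trace after θ: the lax unit law turns eps' back into F eps,
    and lax associativity gathers the constraints on the right. *)
Lemma lax_trace_target (V : B) (P : B S V) :
  lunit (lax F P) ∘ ((lax_ev ⊗ idm (lax F P))
    ∘ assoc (lax F N) (lax F M) (lax F P))
  = fmap (lax F) (lunit P ∘ ((ev D ⊗ idm P) ∘ assoc N M P))
    ∘ (lax_comp F N (M ⊙ P) ∘ (idm (lax F N) ⊗ lax_comp F M P)).
Proof.
rewrite -lax_lunit -!comp_assoc (precomp1 (esym (whiskerR_comp _ _ _))).
rewrite lax_unit_ev whiskerR_comp -!comp_assoc.
rewrite (precomp (lax_comp_natl _ _)) (comp_assoc (lax_comp F _ P)).
by rewrite lax_assoc !fmap_comp -!comp_assoc.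
Qed.

(** The part of the trace before θ, without the 2-cell being traced.  The factor
    c_{M,N}^-1 in eta' is cancelled by the c_{M,N} that lax associativity
    produces. *)
Lemma lax_trace_source (V : B) (Q : B V R) :
  lax_comp F (Q ⊙ M) N ∘ ((lax_comp F Q M ⊗ idm (lax F N))
    ∘ (assoc (lax F Q) (lax F M) (lax F N)
       ∘ ((idm (lax F Q) ⊗ lax_coev) ∘ runiti (lax F Q))))
  = fmap (lax F) (assoc Q M N ∘ ((idm Q ⊗ coev D) ∘ runiti Q)).
Proof.
apply: (inverse_epi (runit_iso (lax F Q))).
rewrite -!comp_assoc (proj1 (runit_iso _)) comp_idr.
rewrite (comp_assoc (_ ⊗ _)) (comp_assoc (lax_comp F _ N)) (comp_assoc (lax_comp F _ N)).
rewrite lax_assoc -!comp_assoc -whiskerL_comp lax_comp_coev whiskerL_comp.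
rewrite (precomp (lax_comp_natr _ _)) !fmap_comp -lax_runit.
by rewrite -!comp_assoc (inverse_cancel _ (fmap_inverse _ (runit_iso _))).
Qed.

Lemma lax_triangle_left :
  runit (lax F M) ∘ (idm (lax F M) ⊗ lax_ev)
    ∘ associ (lax F M) (lax F N) (lax F M)
    ∘ (lax_coev ⊗ idm (lax F M)) ∘ luniti (lax F M) = idm (lax F M).
Proof.
rewrite -lax_runit -!comp_assoc (precomp1 (esym (whiskerL_comp _ _ _))).
rewrite lax_unit_ev whiskerL_comp -!comp_assoc.
rewrite (precomp (lax_comp_natr _ _)).
rewrite (comp_assoc (_ ⊗ _) (associ _ _ _)) (comp_assoc (lax_comp F _ _)) lax_associ.
rewrite -!comp_assoc (precomp1 (esym (whiskerR_comp _ _ _))) lax_comp_coev.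
rewrite whiskerR_comp -!comp_assoc (precomp (lax_comp_natl _ _)).
rewrite !(precomp1 (esym (fmap_comp _ _ _))) -!comp_assoc duality_lunit.
by rewrite !comp_assoc lax_lunit (proj2 (lunit_iso _)).
Qed.

Lemma lax_triangle_right :
  lunit (lax F N) ∘ (lax_ev ⊗ idm (lax F N))
    ∘ assoc (lax F N) (lax F M) (lax F N)
    ∘ (idm (lax F N) ⊗ lax_coev) ∘ runiti (lax F N) = idm (lax F N).
Proof.
rewrite -!comp_assoc (comp_assoc (lax_ev ⊗ _)) (comp_assoc (lunit _)).
rewrite lax_trace_target -!comp_assoc (precomp1 (esym (whiskerL_comp _ _ _))).
rewrite lax_comp_coev whiskerL_comp -!comp_assoc.
rewrite (precomp (lax_comp_natr _ _)) (precomp1 (esym (fmap_comp _ _ _))).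
rewrite -!comp_assoc duality_runit.
by rewrite !comp_assoc lax_runit (proj2 (runit_iso _)).
Qed.

Definition lax_duality : duality (lax F M) (lax F N) :=
  Duality lax_triangle_left lax_triangle_right.

End Duality.
End LaxFunctor.

(** * The trace formula *)

(** Pulling the lax constraints out of the two parts of the trace leaves, around
    θ, the c_{M ⊙ P,N} and c_{N,M ⊙ P} that the axiom relating φ to θ needs; the
    remaining c_{M,P} passes through θ by naturality. *)
Lemma lax_shadow_trace (B C : bicategory) (T Z : category)
  (shB : shadow_functor B T) (shC : shadow_functor C Z)
  (F : lax_shadow_functor shB shC)
  (R S : B) (M : B R S) (N : B S R) (D : duality M N)
  (ci : lax F (M ⊙ N) ~> lax F M ⊙ lax F N)
  (ii : lax F (unit1 S) ~> unit1 (lax0 F S))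
  (ciP : is_inverse (lax_comp F M N) ci) (iiP : is_inverse (lax_unit F S) ii)
  (P : B S S) (cinv : lax F (M ⊙ P) ~> lax F M ⊙ lax F P)
  (cinvP : is_inverse (lax_comp F M P) cinv)
  (Q : B R R) (f : Q ⊙ M ~> M ⊙ P) :
  lsf_phi F P
    ∘ trace shC (lax_duality D ciP iiP) (cinv ∘ fmap (lax F) f ∘ lax_comp F Q M)
  = fmap (lsf_tr F) (trace shB D f) ∘ lsf_phi F Q.
Proof.
rewrite !trace_split; set g := cinv ∘ _ ∘ _.
rewrite [ev _]/= [coev _]/= (lax_trace_target D iiP).
set x := lunit P ∘ _; set y := (f ⊗ idm N) ∘ _; set y' := (g ⊗ _) ∘ _.
have yE : fmap (lax F) y
    = lax_comp F (M ⊙ P) N ∘ ((lax_comp F M P ⊗ idm (lax F N)) ∘ y').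
  rewrite /y' (precomp1 (esym (whiskerR_comp _ _ _))) /g -!comp_assoc.
  rewrite (inverse_cancel _ (inverse_sym cinvP)) whiskerR_comp -!comp_assoc.
  rewrite (precomp (lax_comp_natl _ _ _)) (lax_trace_source D ciP).
  by rewrite -fmap_comp.
clearbody x y y'.
rewrite !fmap_comp -!comp_assoc -lsf_phi_nat yE !fmap_comp.
rewrite (precomp (lsf_phi_nat _ _)).
rewrite -(precomp (theta_nat _ _ _)).
by rewrite !comp_assoc -!(comp_assoc (fmap _ (fmap _ x))) lsf_phi_theta.
Qed.

Theorem proposition8p3 (B C : bicategory) (T Z : category)
    (shB : shadow_functor B T) (shC : shadow_functor C Z)
    (F : lax_shadow_functor shB shC)
    (R S : B) (M : B R S) (Mstar : B S R) (D : duality M Mstar)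
    (hc : is_iso (lax_comp F M Mstar))
    (hi : is_iso (lax_unit F S)) :
  is_right_dual (lax F M) (lax F Mstar) /\
  (forall (P : B S S) (cinv : lax F (M ⊙ P) ~> lax F M ⊙ lax F P),
     is_inverse (lax_comp F M P) cinv ->
     forall (Q : B R R) (f : Q ⊙ M ~> M ⊙ P)
       (N : C (lax0 F S) (lax0 F R)) (DF : duality (lax F M) N),
       lsf_phi F P ∘ trace shC DF (cinv ∘ fmap (lax F) f ∘ lax_comp F Q M)
       = fmap (lsf_tr F) (trace shB D f) ∘ lsf_phi F Q).
Proof.
case: hc => ci ciP; case: hi => ii iiP.
split; first exact: (inhabits (lax_duality D ciP iiP)).
move=> P cinv cinvP Q f N DF.
by rewrite (trace_dual_irrelevant _ DF (lax_duality D ciP iiP)) lax_shadow_trace.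
Qed.
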